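(* Suppose $\frac n2-\sqrt n<k<\frac n2$. There exist universal constants $C,c>0$ such that $$\inf_{\hat\theta}\ \sup_{\theta\in\mathbb{R},\ \|\gamma\|_0\le k}P_{\theta,\gamma}\left\{|\hat\theta-\theta|>C\sqrt{\log\Big(1+\frac{n}{(n-2k)^2}\Big)}\right\}\ge c,$$ where the infimum is over all estimators (measurable functions of $X_1,\dots,X_n$).
   Context: Model: for an integer $n\ge 2$, observations $X_j=\theta+\gamma_j+ Z_j$, $j=1,\dots,n$ (unit variance), where $\theta\in\mathbb{R}$, $\gamma\in\mathbb{R}^n$ and $Z_1,\dots,Z_n$ are i.i.d. $N(0,1)$; $P_{\theta,\gamma}$ denotes the joint law of $(X_1,\dots,X_n)$. $\|\gamma\|_0=\#\{j:\gamma_j\neq 0\}$. *)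

(* Defs.v *)
From HB Require Import structures.
From mathcomp Require Import all_boot all_order all_algebra.
From mathcomp Require Import all_classical all_reals all_analysis.
Set Implicit Arguments. Unset Strict Implicit. Unset Printing Implicit Defensive.
Import Order.TTheory GRing.Theory Num.Theory.
Local Open Scope classical_set_scope.
Local Open Scope ring_scope.

Definition l0norm {R : realType} (n : nat) (g : 'I_n -> R) : nat :=
  #|[set i : 'I_n | g i != 0]|.

Definition iid_std_normal {R : realType} (d : measure_display)
  (Omega : measurableType d) (P : probability Omega R) (n : nat)
  (Z : 'I_n -> Omega -> R) : Prop :=
  (forall i, measurable_fun setT (Z i)) /\
  (forall i (B : set R), measurable B ->
     P (Z i @^-1` B) = normal_prob 0 1 B) /\
  (forall B : 'I_n -> set R, (forall i, measurable (B i)) ->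
     P (\bigcap_(i in [set: 'I_n]) (Z i @^-1` B i)) =
     (\prod_(i < n) P (Z i @^-1` B i))%E).

Definition obs {R : realType} {Omega : Type} (n : nat) (theta : R)
  (gamma : 'I_n -> R) (Z : 'I_n -> Omega -> R) (w : Omega) : n.-tuple R :=
  [tuple theta + gamma i + Z i w | i < n].

Definition err_prob {R : realType} (d : measure_display)
  (Omega : measurableType d) (P : probability Omega R) (n : nat)
  (Z : 'I_n -> Omega -> R) (est : n.-tuple R -> R) (theta : R)
  (gamma : 'I_n -> R) (t : R) : \bar R :=
  P [set w | t < `|est (obs theta gamma Z w) - theta| ].

(* Main.v *)
Require Import Defs.
From HB Require Import structures.
From mathcomp Require Import all_boot all_order all_algebra.
From mathcomp Require Import all_classical all_reals all_analysis.
From mathcomp Require Import measurable_realfun zify ring lra.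
Set Implicit Arguments.
Unset Strict Implicit.
Unset Printing Implicit Defensive.
Import Order.TTheory GRing.Theory Num.Theory.
Import HBNNSimple.
Local Open Scope classical_set_scope.
Local Open Scope ring_scope.

(** Let [m = n - 2k] and [a = sqrt (ln (1 + n / m^2)) / 8].  For a set [S] of
indices, let [P_S] be the law of the sample with mean [a] on [S] and [-a] off
[S].  If [#|S| = k], then [P_S] is the law for [theta = -a] with [k] outliers;
if [#|S| = n - k], it is the law for [theta = a] with [k] outliers.

Moving coordinate [j] from [-a] to [a] multiplies the density of [P_S] by
[L_j = exp (h Z_j - h^2 / 2)], [h = 2a].  Under [P_S] the variables [L_j - 1],
[j] outside [S], are orthogonal with squared norm [exp (h^2) - 1].  By Bessel's
inequality the average over [j] of [P_{S + j}(A)] differs from [P_S(A)] by at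
most [sqrt ((exp (h^2) - 1) / (n - #|S|))], so some [j] loses at most that much.
Adding [m] indices greedily goes from a set of size [k] to one of size [n - k].
As [n - #|S| > k] and [4 (k + 1) >= n], and as [exp (h^2) = (1 + n / m^2)^(1/16)]
is at most [1 + n / (16 m^2)], the total loss is at most [1 / 2].  With
[A = {est <= 0}], the estimator errs by at least [a] with probability at least
[1 / 4] under one of the two end points. *)

Lemma ge0_integral_density d (T : measurableType d) (R : realType)
    (mu nu : {measure set T -> \bar R}) (g : T -> R) :
    measurable_fun setT g -> (forall x, 0 <= g x) ->
    (forall A, measurable A -> nu A = \int[mu]_(x in A) (g x)%:E)%E ->
  forall (D : set T) (f : T -> \bar R), measurable D -> measurable_fun D f ->
    (forall x, 0 <= f x)%E ->
  (\int[nu]_(x in D) f x = \int[mu]_(x in D) (f x * (g x)%:E))%E.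
Proof.
move=> mg g0 nuE D f mD mf f0.
have mgE : measurable_fun D (EFin \o g) by exact/measurable_funTS/measurable_EFinP.
pose h := nnsfun_approx mD mf.
have -> : (\int[nu]_(x in D) f x =
    lim (\int[nu]_(x in D) (EFin \o h n) x @[n --> \oo]))%E.
  have fE x : D x -> f x = lim ((EFin \o h n) x @[n --> \oo]).
    by move=> Dx; apply/esym/cvg_lim => //; exact: cvg_nnsfun_approx.
  under eq_integral => x /[!inE] /fE -> //.
  apply: monotone_convergence => //.
  - by move=> n; apply/measurable_EFinP/measurable_funTS.
  - by move=> n x Dx //=; rewrite lee_fin.
  - by move=> x Dx a b ab; rewrite lee_fin; exact/lefP/nd_nnsfun_approx.
have -> : (\int[mu]_(x in D) (f x * (g x)%:E) =
    lim (\int[mu]_(x in D) ((h n x)%:E * (g x)%:E) @[n --> \oo]))%E.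
  have fg x : D x -> (f x * (g x)%:E = lim ((h n x)%:E * (g x)%:E @[n --> \oo]))%E.
    by move=> Dx; apply/esym/cvg_lim => //; apply: cvgeZr => //;
      exact: cvg_nnsfun_approx.
  under eq_integral => x /[!inE] /fg -> //.
  apply: monotone_convergence => [//| | |].
  - by move=> n; apply/emeasurable_funM => //; exact/measurable_EFinP/measurable_funTS.
  - by move=> n x Dx /=; rewrite mule_ge0 ?lee_fin.
  - move=> x Dx a b ab/=; rewrite lee_wpmul2r ?lee_fin//.
    exact/lefP/nd_nnsfun_approx.
suff intE n : (\int[nu]_(x in D) (EFin \o h n) x =
    \int[mu]_(x in D) ((h n x)%:E * (g x)%:E))%E.
  by under eq_fun do rewrite intE.
pose F y x := ((y * \1_(h n @^-1` [set y]) x)%:E : \bar R).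
have mF y : measurable_fun D (F y).
  by apply/measurable_EFinP/measurable_funTS/measurable_funM.
have F0 y x : (0 <= F y x)%E by exact: nnfun_muleindic_ge0.
transitivity (\int[nu]_(x in D) (\sum_(y \in range (h n)) F y x))%E.
  by apply: eq_integral => t tD; rewrite /= fimfunE -fsumEFin.
transitivity (\int[mu]_(x in D) (\sum_(y \in range (h n)) (F y x * (g x)%:E)))%E;
    last first.
  apply: eq_integral => t tD.
  rewrite -ge0_mule_fsuml => [|y]; last exact: nnfun_muleindic_ge0.
  by rewrite fsumEFin // -(fimfunE _ t).
rewrite !ge0_integral_fsum//; first last. 
- by move=> y x Dx; rewrite mule_ge0 ?lee_fin//; exact: (F0 y x).
- by move=> y; apply: emeasurable_funM.
apply: eq_fsbigr => r rhn.
have r0 : 0 <= r by move: rhn; rewrite inE => -[t _ <-].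
have mr : measurable (h n @^-1` [set r]) by [].
under eq_integral do rewrite /F EFinM.
under [RHS]eq_integral do rewrite /F EFinM -muleA.
rewrite !ge0_integralZl//; first last.
- exact/measurable_EFinP/measurable_funTS.
- by move=> x _; rewrite mule_ge0 ?lee_fin.
- by apply: emeasurable_funM => //; exact/measurable_EFinP/measurable_funTS.
rewrite integral_indic// nuE; last exact: measurableI.
congr (_ * _)%E; rewrite setIC integral_mkcondr.
by apply: eq_integral => x _; rewrite epatch_indic muleC.
Qed.

Lemma lebesgue_measure_shift (R : realType) (h : R) (A : set (measurableTypeR R)) :
  measurable A ->
  lebesgue_measure
    ((fun x : measurableTypeR R => (x + h : measurableTypeR R)) @^-1` A) =
  lebesgue_measure A.
Proof.
move=> mA.
pose s := fun x : measurableTypeR R => (x + h : measurableTypeR R).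
have ms : measurable_fun setT s by apply: measurable_funD.
pose sP : {mfun _ >-> _} := HB.pack s (isMeasurableFun.Build _ _ _ _ _ ms).
have /(_ A mA) : forall A, measurable A ->
    lebesgue_measure A = pushforward lebesgue_measure sP A.
  apply: lebesgue_measure_unique => _ [[a b]] _ <-.
  have sab : s @^-1` `]a, b]%classic = `]a - h, b - h]%classic.
    by apply/seteqP; split => x; rewrite /s /= !in_itv /= ltrBlDr lerBrDr.
  transitivity (lebesgue_measure (`]a - h, b - h]%classic : set (measurableTypeR R))).
    by rewrite !lebesgue_measure_itv/= !lte_fin ltrD2r -!EFinB opprD addrACA subrr addr0.
  by rewrite -sab.
by [].
Qed.

Definition tilt {R : realType} (h x : R) : R := expR (h * x - h ^+ 2 / 2).

Lemma tilt_ge0 (R : realType) (h x : R) : 0 <= tilt h x.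
Proof. exact: expR_ge0. Qed.

Lemma measurable_tilt (R : realType) (h : R) : measurable_fun setT (tilt h).
Proof.
by apply: measurableT_comp => //; apply: measurable_funB => //; exact: measurable_funM.
Qed.

Lemma normal_pdf_shift (R : realType) (h x : R) :
  normal_pdf 0 1 (x - h) = tilt h x * normal_pdf 0 1 x.
Proof.
rewrite normal_pdfE ?oner_eq0// /tilt mulrCA; congr (_ * _).
rewrite /normal_fun -expRD; congr expR.
rewrite !subr0 expr1n mulr2n -(mulr1 1).
by field.
Qed.

Lemma normal_prob_shift (R : realType) (h : R) (B : set (measurableTypeR R)) :
  measurable B ->
  (normal_prob 0 1 [set x | B (x + h)%R] =
   \int[normal_prob (0:R) 1]_(x in B) (tilt h x)%:E)%E.
Proof.
move=> mB.
pose s := fun x : measurableTypeR R => (x + h : measurableTypeR R).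
have ms : measurable_fun setT s by apply: measurable_funD.
rewrite (@ge0_integral_density _ _ _ lebesgue_measure _ (normal_pdf (0:R) 1))//; last first.
- by move=> x; rewrite lee_fin tilt_ge0.
- apply/measurable_EFinP/measurable_funTS; exact: measurable_tilt.
- exact: normal_pdf_ge0.
- exact: measurable_normal_pdf.
under [RHS]eq_integral do rewrite -EFinM -normal_pdf_shift.
transitivity (\int[lebesgue_measure]_(x in s @^-1` B)
   ((fun y : measurableTypeR R => (normal_pdf 0 1 (y - h))%:E) \o s) x)%E.
  by apply: eq_integral => x _; rewrite /= /s addrK.
rewrite -ge0_integral_pushforward//.
- by apply: eq_measure_integral => A mA _; exact: lebesgue_measure_shift.
- apply/measurable_EFinP/measurable_funTS.
  apply: (measurableT_comp (measurable_normal_pdf _ _)); exact: measurable_funB.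
- by move=> x _; rewrite lee_fin normal_pdf_ge0.
Qed.

Section weighted_measure.
Context d (T : measurableType d) (R : realType) (mu : {measure set T -> \bar R}).
Variable g : T -> R.

Definition weighted of measurable_fun setT g & (forall x, 0 <= g x) :=
  fun A => (\int[mu]_(x in A) (g x)%:E)%E.

Hypotheses (mg : measurable_fun setT g) (g0 : forall x, 0 <= g x).

Let weighted0 : weighted mg g0 set0 = 0%E. Proof. exact: integral_set0. Qed.

Let weighted_ge0 A : (0 <= weighted mg g0 A)%E.
Proof. by apply: integral_ge0 => x _; rewrite lee_fin. Qed.

Let weighted_sigma_additive : semi_sigma_additive (weighted mg g0).
Proof.
apply: (@semi_sigma_additive_nng_induced _ _ _ mu (EFin \o g)) => //.
exact/measurable_EFinP.
Qed.

HB.instance Definition _ := isMeasure.Build _ _ _ (weighted mg g0)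
  weighted0 weighted_ge0 weighted_sigma_additive.

End weighted_measure.

Definition box {R : realType} {n : nat} (B : 'I_n -> set R) : set (n.-tuple R) :=
  [set t | forall i, B i (tnth t i)].

Lemma measurable_box (R : realType) n (B : 'I_n -> set R) :
  (forall i, measurable (B i)) -> measurable (box B).
Proof.
move=> mB.
have -> : box B = \bigcap_(i in [set: 'I_n]) ((fun t => tnth t i) @^-1` B i).
  by apply/seteqP; split => t Bt i; [move=> _|]; exact: Bt.
apply: fin_bigcap_measurable => // i _.
by rewrite -[_ @^-1` _]setTI; exact: measurable_tnth.
Qed.

Lemma measurable_tuple_box (R : realType) n :
  measurable = <<s [set A : set (n.-tuple R) |
    exists2 B : 'I_n -> set R, (forall i, measurable (B i)) & A = box B] >>.
Proof.
apply/seteqP; split; last first.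
  apply: smallest_sub; first exact: sigma_algebra_measurable.
  by move=> _ [B mB ->]; exact: measurable_box.
apply: smallest_sub; first exact: smallest_sigma_algebra.
move=> A; rewrite -bigcup_seq => -[i _ [B mB <-]].
apply: sub_sigma_algebra.
exists (fun k => if k == i then B else setT).
  by move=> k; case: ifP.
rewrite setTI; apply/seteqP; split => t /=.
  by move=> Bt k; case: eqP => // ->.
by move=> /(_ i); rewrite eqxx.
Qed.

Lemma tuple_measure_unique (R : realType) n
    (m1 m2 : {measure set (n.-tuple R) -> \bar R}) :
    (m1 setT < +oo)%E ->
    (forall B : 'I_n -> set R, (forall i, measurable (B i)) ->
      m1 (box B) = m2 (box B)) ->
  forall A, measurable A -> m1 A = m2 A.
Proof.
move=> m1oo m12; apply: (measure_unique _ (fun=> setT) (measurable_tuple_box R n)).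
- move=> _ _ [B mB ->] [C mC ->]; exists (fun i => B i `&` C i).
    by move=> i; exact: measurableI.
  apply/seteqP; split => t /=; first by move=> [Bt Ct] i; split.
  by move=> BCt; split => i; have [] := BCt i.
- by move=> _; exists (fun=> setT) => //; apply/seteqP; split.
- by rewrite bigcup_const.
- by move=> _ [B mB ->]; exact: m12.
- by [].
Qed.

Section gaussian_shift.
Context (R : realType) d (Omega : measurableType d) (P : probability Omega R).
Context (n : nat) (Z : 'I_n -> Omega -> R).
Hypothesis iidZ : iid_std_normal P Z.

Let mZ i : measurable_fun setT (Z i). Proof. by case: iidZ. Qed.

Let mZV i B : measurable B -> measurable (Z i @^-1` B).
Proof. by move=> mB; rewrite -[_ @^-1` _]setTI; exact: mZ. Qed.

Lemma iid_std_normal_cap (B : 'I_n -> set R) : (forall i, measurable (B i)) ->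
  P (\bigcap_(i in [set: 'I_n]) (Z i @^-1` B i)) =
  (\prod_(i < n) normal_prob 0 1 (B i))%E.
Proof.
case: iidZ => _ [PZ indep] mB; rewrite indep//.
by apply: eq_bigr => i _; rewrite PZ.
Qed.

Lemma measurable_shifted_tuple (v : 'I_n -> R) :
  measurable_fun setT (fun w => [tuple Z i w + v i | i < n]).
Proof.
apply/measurable_fun_tnthP => i.
rewrite (_ : _ \o _ = fun w => Z i w + v i); first exact: measurable_funD.
by apply/funext => w /=; rewrite tnth_mktuple.
Qed.

Lemma integral_tilt_cap (j : 'I_n) (h : R) (B : 'I_n -> set R) :
  (forall i, measurable (B i)) ->
  (\int[P]_(w in \bigcap_(i in [set: 'I_n]) (Z i @^-1` B i)) (tilt h (Z j w))%:E =
   normal_prob 0 1 [set x | B j (x + h)%R] *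
   \prod_(i < n | i != j) normal_prob 0 1 (B i))%E.
Proof.
move=> mB.
pose c : R := \prod_(i < n | i != j) fine (normal_prob 0 1 (B i)).
have cE : (\prod_(i < n | i != j) normal_prob 0 1 (B i) = c%:E)%E.
  rewrite /c -prodEFin; apply: eq_bigr => i _; rewrite fineK//.
  by apply: fin_num_measure; exact: mB.
have c0 : 0 <= c by apply: prodr_ge0 => i _; exact: fine_ge0.
pose C D i := if i == j then D else B i.
have mC D i : measurable D -> measurable (C D i) by rewrite /C; case: ifP.
pose F := \bigcap_(i in [set: 'I_n]) (Z i @^-1` C setT i).
have mF : measurable F.
  by apply: fin_bigcap_measurable => // i _; apply: mZV; exact: mC.
have FE D : Z j @^-1` D `&` F = \bigcap_(i in [set: 'I_n]) (Z i @^-1` C D i).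
  apply/seteqP; split => w /=.
    move=> [Dw Fw] i _; have := Fw i I; rewrite /C.
    by case: eqP => [->|].
  move=> Fw; split; first by have := Fw j I; rewrite /C eqxx.
  by move=> i _; have := Fw i I; rewrite /C; case: eqP.
have PF D : measurable D -> P (Z j @^-1` D `&` F) = (normal_prob 0 1 D * c%:E)%E.
  move=> mD; rewrite FE iid_std_normal_cap; last by move=> i; exact: mC.
  rewrite (bigD1 j)//= /C eqxx -cE; congr (_ * _)%E.
  by apply: eq_bigr => i /negbTE ->.
have -> : \bigcap_(i in [set: 'I_n]) (Z i @^-1` B i) = Z j @^-1` (B j) `&` F.
  by rewrite FE; apply: eq_bigcapr => i _; rewrite /C; case: eqP => [->|].
have mBj : measurable (B j : set (measurableTypeR R)) by exact: mB.
have mtilt : measurable_fun (B j) (fun x : measurableTypeR R => (tilt h x)%:E).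
  by apply/measurable_EFinP/measurable_funTS; exact: measurable_tilt.
have mtZ D : measurable_fun D (fun w => (tilt h (Z j w))%:E).
  apply/measurable_EFinP/measurable_funTS.
  exact: (measurableT_comp (measurable_tilt h) (mZ j)).
have mZj : measurable_fun setT (Z j : Omega -> measurableTypeR R) by exact: mZ.
pose Zj : {mfun Omega >-> measurableTypeR R} :=
  HB.pack (Z j : Omega -> measurableTypeR R) (isMeasurableFun.Build _ _ _ _ _ mZj).
transitivity (\int[pushforward (mrestr P mF) Zj]_(x in B j) (tilt h x)%:E)%E.
  rewrite (ge0_integral_pushforward mZj _ mBj)//; last first.
    by move=> x _; rewrite lee_fin tilt_ge0.
  rewrite (@ge0_integral_density _ _ _ P _ (\1_F))//=; last 3 first.
  - by move=> A mA; rewrite integral_indic// setIC.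
  - exact: mZV.
  - by move=> w; rewrite lee_fin tilt_ge0.
  rewrite integral_mkcondr; apply: eq_integral => w _.
  by rewrite epatch_indic.
have nuE (A : set (measurableTypeR R)) : measurable A -> pushforward (mrestr P mF) Zj A =
    (\int[normal_prob (0:R) 1]_(x in A) (cst c x)%:E)%E.
  move=> mA; transitivity (c%:E * normal_prob 0 1 A)%E; first by rewrite muleC -PF.
  exact/esym/(integral_cst (normal_prob (0:R) 1) mA c%:E).
have mc : measurable_fun [set: measurableTypeR R] (cst c) by [].
have t0 x : (0 <= (tilt h x)%:E)%E by rewrite lee_fin tilt_ge0.
have density m := ge0_integral_density
  (nu := measure_function_pushforward__canonical__measure_function_Measure
    (mrestr P mF) m) mc (fun=> c0) nuE mBj mtilt t0.
apply: (eq_trans (density mZj)).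
have c0E : (0 <= c%:E)%E by rewrite lee_fin.
apply: (eq_trans (ge0_integralZr (normal_prob (0:R) 1) mBj mtilt (fun x _ => t0 x) c0E)).
by rewrite cE normal_prob_shift.
Qed.

Lemma gaussian_shift (j : 'I_n) (h : R) (f : n.-tuple R -> \bar R) :
  measurable_fun setT f -> (forall t, 0 <= f t)%E ->
  (\int[P]_w f [tuple (Z i w + h *+ (i == j))%R | i < n] =
   \int[P]_w (f [tuple Z i w | i < n] * (tilt h (Z j w))%:E))%E.
Proof.
move=> mf f0.
have m0 : measurable_fun setT (fun w => [tuple Z i w | i < n]).
  have := measurable_shifted_tuple (fun=> 0).
  by under eq_fun do under eq_mktuple do rewrite addr0.
pose Zt : {mfun Omega >-> n.-tuple R} :=
  HB.pack (fun w => [tuple Z i w | i < n]) (isMeasurableFun.Build _ _ _ _ _ m0).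
have ms := measurable_shifted_tuple (fun i => h *+ (i == j)).
pose Zs : {mfun Omega >-> n.-tuple R} :=
  HB.pack (fun w => [tuple Z i w + h *+ (i == j) | i < n])
    (isMeasurableFun.Build _ _ _ _ _ ms).
pose g (t : n.-tuple R) := tilt h (tnth t j).
have mg : measurable_fun setT g.
  exact: (measurableT_comp (measurable_tilt h) (measurable_tnth j)).
have g0 t : 0 <= g t by exact: tilt_ge0.
have law A : measurable A ->
    distribution P Zs A = weighted (distribution P Zt) mg g0 A.
  apply: (tuple_measure_unique (m1 := distribution P Zs)
    (m2 := weighted (distribution P Zt) mg g0)).
    apply: (le_lt_trans (probability_le1 (distribution P Zs) measurableT)).
    exact: ltry.
  move=> B mB.
  apply: esym; apply: (eq_trans (ge0_integral_pushforward (f := EFin \o g)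
    m0 P (measurable_box mB) _ _)).
  - exact/measurable_EFinP/measurable_funTS.
  - by move=> t _; rewrite lee_fin.
  apply: esym.
  pose B' i := [set x | B i (x + h *+ (i == j))].
  have mB' i : measurable (B' i).
    rewrite /B' -[X in measurable X]setTI.
    have mD : measurable_fun setT (fun x : R => x + h *+ (i == j)).
      exact: measurable_funD.
    exact: mD.
  have -> : Zt @^-1` box B = \bigcap_(i in [set: 'I_n]) (Z i @^-1` B i).
    apply/seteqP; split => w Bw i; first by move=> _; have := Bw i; rewrite tnth_mktuple.
    by rewrite tnth_mktuple; exact: Bw.
  transitivity (P (\bigcap_(i in [set: 'I_n]) (Z i @^-1` B' i))).
    rewrite /distribution /pushforward; congr (P _).
    apply/seteqP; split => w Bw i; first by move=> _; have := Bw i; rewrite tnth_mktuple.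
    by rewrite tnth_mktuple; exact: Bw.
  rewrite iid_std_normal_cap// (bigD1 j)//= /B' eqxx mulr1n.
  under [RHS]eq_integral do rewrite /g tnth_mktuple.
  rewrite integral_tilt_cap//; congr (_ * _)%E.
  by apply: eq_bigr => i /negbTE ->; under eq_set do rewrite mulr0n addr0.
transitivity (\int[distribution P Zs]_t f t)%E.
  by rewrite ge0_integral_distribution.
rewrite (ge0_integral_density mg g0 law)//.
rewrite ge0_integral_distribution//.
- by apply: eq_integral => w _; rewrite /= /g tnth_mktuple.
- by apply: emeasurable_funM => //; exact/measurable_EFinP.
- by move=> t; rewrite mule_ge0// lee_fin.
Qed.

End gaussian_shift.

Section nonnegative_mean.
Context (R : realType) d (Omega : measurableType d) (P : probability Omega R).

Definition nneg_mean (f : Omega -> R) (r : R) : Prop :=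
  [/\ measurable_fun setT f, forall w, 0 <= f w &
      (\int[P]_w (f w)%:E = r%:E)%E].

Lemma nneg_mean_cst c : 0 <= c -> nneg_mean (fun=> c) c.
Proof.
move=> c0; split => //.
transitivity (c%:E * P setT)%E; first exact: (integral_cst P measurableT c%:E).
by rewrite probability_setT mule1.
Qed.

Lemma nneg_mean_indic A : measurable A -> nneg_mean \1_A (fine (P A)).
Proof.
move=> mA; split; [exact: measurable_indic|by []|].
by rewrite integral_indic// setIT fineK// fin_num_measure.
Qed.

Lemma nneg_meanD f g r s : nneg_mean f r -> nneg_mean g s ->
  nneg_mean (fun w => f w + g w) (r + s).
Proof.
move=> [mf f0 fr] [mg g0 gs]; split.
- exact: measurable_funD.
- by move=> w; rewrite addr_ge0.
- under eq_integral do rewrite EFinD.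
  rewrite ge0_integralD//; first by rewrite fr gs.
  + by move=> w _; rewrite lee_fin.
  + exact/measurable_EFinP.
  + by move=> w _; rewrite lee_fin.
  + exact/measurable_EFinP.
Qed.

Lemma nneg_meanZ c f r : 0 <= c -> nneg_mean f r ->
  nneg_mean (fun w => c * f w) (c * r).
Proof.
move=> c0 [mf f0 fr]; split.
- exact: measurable_funM.
- by move=> w; rewrite mulr_ge0.
- under eq_integral do rewrite EFinM.
  rewrite ge0_integralZl_EFin//; first by rewrite fr.
  + by move=> w _; rewrite lee_fin.
  + exact/measurable_EFinP.
Qed.

Lemma nneg_mean_sum (I : Type) (s : seq I) (f : I -> Omega -> R) (r : I -> R) :
  (forall i, nneg_mean (f i) (r i)) ->
  nneg_mean (fun w => \sum_(i <- s) f i w) (\sum_(i <- s) r i).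
Proof.
move=> fr; elim: s => [|i s IHs].
  rewrite big_nil (_ : (fun _ => _) = fun=> 0); first exact: nneg_mean_cst.
  by apply/funext => w; rewrite big_nil.
rewrite big_cons (_ : (fun _ => _) = fun w => f i w + \sum_(i <- s) f i w).
  exact: nneg_meanD.
by apply/funext => w; rewrite big_cons.
Qed.

Lemma le_nneg_mean f g r s : nneg_mean f r -> nneg_mean g s ->
  (forall w, f w <= g w) -> r <= s.
Proof.
move=> [mf f0 fr] [mg g0 gs] fg; rewrite -lee_fin -fr -gs.
apply: ge0_le_integral => //.
- by move=> w _; rewrite lee_fin.
- exact/measurable_EFinP.
- exact/measurable_EFinP.
- by move=> w _; rewrite lee_fin.
Qed.

End nonnegative_mean.

Section tilt_means.
Context (R : realType) d (Omega : measurableType d) (P : probability Omega R).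
Context (n : nat) (Z : 'I_n -> Omega -> R).
Hypothesis iidZ : iid_std_normal P Z.

Let mZ i : measurable_fun setT (Z i). Proof. by case: iidZ. Qed.

Let mtZ h i : measurable_fun setT (fun w => tilt h (Z i w)).
Proof. exact: (measurableT_comp (measurable_tilt h) (mZ i)). Qed.

Definition shift_event (A : set (n.-tuple R)) (v : 'I_n -> R) : set Omega :=
  [set w | A [tuple Z i w + v i | i < n]].

Lemma indic_shift_event A v w :
  \1_(shift_event A v) w = \1_A [tuple Z i w + v i | i < n] :> R.
Proof. by rewrite !indicE; congr (_%:R); apply/idP/idP; rewrite !inE. Qed.

Lemma measurable_shift_event A v : measurable A -> measurable (shift_event A v).
Proof.
move=> mA; rewrite -[shift_event A v]setTI.
exact: (measurable_shifted_tuple iidZ v).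
Qed.

Lemma nneg_mean_tilt h j : nneg_mean P (fun w => tilt h (Z j w)) 1.
Proof.
split => //; first by move=> w; exact: tilt_ge0.
have [_ _ <-] := nneg_mean_cst P (@ler01 R).
apply: esym; apply: (eq_trans (gaussian_shift iidZ j h (measurable_cst 1%E) _)) => //.
by apply: eq_integral => w _; rewrite mul1e.
Qed.

Lemma nneg_mean_tilt2 h i j :
  nneg_mean P (fun w => tilt h (Z i w) * tilt h (Z j w))
    (if i == j then expR (h ^+ 2) else 1).
Proof.
split; first exact: measurable_funM.
  by move=> w; rewrite mulr_ge0 ?tilt_ge0.
pose f (t : n.-tuple R) := (tilt h (tnth t i))%:E.
have mf : measurable_fun setT f.
  apply/measurable_EFinP.
  exact: (measurableT_comp (measurable_tilt h) (measurable_tnth i)).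
have f0 t : (0 <= f t)%E by rewrite lee_fin tilt_ge0.
have := gaussian_shift iidZ j h mf f0; rewrite /f.
under [RHS]eq_integral do rewrite tnth_mktuple -EFinM.
move=> <-.
under eq_integral do rewrite tnth_mktuple.
case: eqP => [_|_]; last first.
  under eq_integral do rewrite mulr0n addr0.
  by case: (nneg_mean_tilt h i).
have [_ _] := nneg_meanZ (expR_ge0 (h ^+ 2)) (nneg_mean_tilt h i).
rewrite mulr1 => <-; apply: eq_integral => w _.
by rewrite /tilt -expRD; congr (expR _)%:E; rewrite mulr1n; ring.
Qed.

Lemma nneg_mean_indic_tilt A v h j : measurable A ->
  nneg_mean P (fun w => \1_(shift_event A v) w * tilt h (Z j w))
    (fine (P (shift_event A (fun i => v i + h *+ (i == j))))).
Proof.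
move=> mA; split.
- by apply: measurable_funM => //; apply: measurable_indic; exact: measurable_shift_event.
- by move=> w; rewrite mulr_ge0 ?tilt_ge0.
have mvt : measurable_fun setT (fun t : n.-tuple R => [tuple tnth t i + v i | i < n]).
  apply/measurable_fun_tnthP => i.
  rewrite (_ : _ \o _ = fun t => tnth t i + v i).
    by apply: measurable_funD => //; exact: measurable_tnth.
  by apply/funext => t /=; rewrite tnth_mktuple.
pose f (t : n.-tuple R) : \bar R := (\1_A [tuple tnth t i + v i | i < n])%:E.
have mf : measurable_fun setT f.
  apply/measurable_EFinP; apply: (measurableT_comp _ mvt).
  exact: measurable_indic.
have f0 t : (0 <= f t)%E by rewrite lee_fin.
have := gaussian_shift iidZ j h mf f0; rewrite /f.
have [_ _ <-] := nneg_mean_indic P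
  (measurable_shift_event (fun i => v i + h *+ (i == j)) mA).
move=> E; transitivity (\int[P]_w f [tuple (Z i w + h *+ (i == j))%R | i < n])%E.
  rewrite E; apply: eq_integral => w _; rewrite EFinM indic_shift_event /f.
  rewrite (_ : [tuple Z i w + v i | i < n] =
    [tuple tnth [tuple Z i w | i < n] i + v i | i < n])//.
  by apply: eq_from_tnth => i; rewrite !tnth_mktuple.
apply: eq_integral => w _; rewrite indic_shift_event /f; congr (\1_A _)%:E.
by apply: eq_from_tnth => i; rewrite !tnth_mktuple addrAC addrA.
Qed.

End tilt_means.

Section shift_stability.
Context (R : realType) d (Omega : measurableType d) (P : probability Omega R).
Context (n : nat) (Z : 'I_n -> Omega -> R).
Hypothesis iidZ : iid_std_normal P Z.

Lemma exists_shift_ge (A : set (n.-tuple R)) (v : 'I_n -> R) (h lam : R)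
    (s : seq 'I_n) : measurable A -> 0 < lam -> uniq s -> (0 < size s)%N ->
  exists2 j, j \in s &
    fine (P (shift_event Z A v)) -
      (lam / 2 * (expR (h ^+ 2) - 1) + (2 * lam * (size s)%:R)^-1) <=
    fine (P (shift_event Z A (fun i => v i + h *+ (i == j)))).
Proof.
move=> mA lam0 us s0.
set p := fine _; set e := expR _; set N : R := (size s)%:R.
pose q j := fine (P (shift_event Z A (fun i => v i + h *+ (i == j)))).
have N0 : 0 < N by rewrite ltr0n.
have sumN (c : R) : \sum_(i <- s) c = N * c.
  by rewrite big_const_seq count_predT iter_addr_0 mulr_natl.
have mb := nneg_mean_indic P (measurable_shift_event iidZ v mA).
have mL := nneg_mean_sum s (nneg_mean_tilt iidZ h).
have mbL := nneg_mean_sum s (fun j => nneg_mean_indic_tilt iidZ v h j mA).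
have mLL := nneg_mean_sum s (fun i => nneg_mean_sum s (nneg_mean_tilt2 iidZ h i)).
have lamN0 : 0 <= lam * N by rewrite mulr_ge0// ltW.
have lam20 : 0 <= lam / 2 by rewrite divr_ge0// ltW.
have c0 : 0 <= lam / 2 * N ^+ 2 + (2 * lam)^-1.
  by apply: addr_ge0; [rewrite mulr_ge0 ?sqr_ge0|rewrite invr_ge0 mulr_ge0// ltW].
have ml := nneg_meanD (nneg_meanZ (ltW N0) mb) (nneg_meanZ lamN0 mL).
have mr := nneg_meanD (nneg_meanD mbL (nneg_meanZ lam20 mLL)) (nneg_mean_cst P c0).
have := le_nneg_mean ml mr.
rewrite -/p -/q sumN.
have -> : \sum_(i <- s) \sum_(j <- s) (if i == j then e else 1) = N * (N + (e - 1)).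
  rewrite -sumN big_seq [RHS]big_seq; apply: eq_bigr => i si.
  transitivity (\sum_(j <- s) (1 + (e - 1) * (i == j)%:R)).
    by apply: eq_bigr => j _; case: eqP => _; rewrite ?mulr1 ?mulr0 ?addr0// addrC subrK.
  rewrite big_split/= sumN mulr1 -mulr_sumr -natr_sum; congr (_ + _).
  rewrite (_ : (\sum_(j <- s) _)%N = 1%N) ?mulr1//.
  rewrite (bigD1_seq i)//= eqxx big1 ?addn0// => j.
  by rewrite eq_sym => /negbTE ->.
move=> main.
have {main}sum_ge : N * p + lam * N * (N * 1) <=
    \sum_(j <- s) q j + lam / 2 * (N * (N + (e - 1))) + (lam / 2 * N ^+ 2 + (2 * lam)^-1).
  apply: main => w; rewrite -mulr_sumr -big_distrlr /=.
  set S := \sum_(i <- s) _; set b := \1_ _ w.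
  have bb : b ^+ 2 = b by rewrite /b indicE; case: (_ \in _); rewrite ?expr1n ?expr0n.
  have b1 : b <= 1 by rewrite /b indicE lern1; case: (_ \in _).
  (* AM-GM: [b (N - S) <= lam / 2 * (N - S) ^+ 2 + b ^+ 2 / (2 * lam)] *)
  have : 0 <= lam / 2 * (N - S - b / lam) ^+ 2 by rewrite mulr_ge0// sqr_ge0.
  have -> : lam / 2 * (N - S - b / lam) ^+ 2 =
      lam / 2 * (N - S) ^+ 2 - b * (N - S) + b ^+ 2 * (2 * lam)^-1.
    by field; rewrite gt_eqF.
  rewrite bb.
  have : b * (2 * lam)^-1 <= (2 * lam)^-1.
    by rewrite ler_piMl// invr_ge0 mulr_ge0// ltW.
  nra.
apply: contrapT => nex.
have qlt j : j \in s -> q j < p - (lam / 2 * (e - 1) + (2 * lam * N)^-1).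
  by move=> sj; rewrite ltNge; apply/negP => ge; apply: nex; exists j.
have : \sum_(j <- s) q j < N * (p - (lam / 2 * (e - 1) + (2 * lam * N)^-1)).
  rewrite -sumN big_seq [ltRHS]big_seq; apply: ltr_sum => //.
  by apply/hasP; case: (s) s0 => // i s' _; exists i; rewrite ?mem_head// inE eqxx.
have -> : N * (p - (lam / 2 * (e - 1) + (2 * lam * N)^-1)) =
    N * p - lam / 2 * (N * (e - 1)) - (2 * lam)^-1.
  by field; rewrite !gt_eqF.
nra.
Qed.

Definition two_point (a : R) (S : {set 'I_n}) (i : 'I_n) : R :=
  if i \in S then a else - a.

Lemma exists_superset_ge (A : set (n.-tuple R)) (a lam : R) (q m : nat)
    (S : {set 'I_n}) :
  measurable A -> 0 < lam -> (0 < q)%N -> (#|S| + m + q <= n.+1)%N ->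
  exists S' : {set 'I_n}, #|S'| = (#|S| + m)%N /\
    fine (P (shift_event Z A (two_point a S))) -
      m%:R * (lam / 2 * (expR ((2 * a) ^+ 2) - 1) + (2 * lam * q%:R)^-1) <=
    fine (P (shift_event Z A (two_point a S'))).
Proof.
move=> mA lam0 q0; set del := (X in _ - _ * X).
elim: m S => [|m IHm] S Sq.
  by exists S; rewrite addn0 mul0r subr0.
have szE : size (enum (~: S)) = (n - #|S|)%N.
  by rewrite -cardE cardsCs finset.setCK card_ord.
have qle : (q <= size (enum (~: S)))%N by rewrite szE; lia.
pose h := 2 * a.
have [|j] := @exists_shift_ge A (two_point a S) h _ _ mA lam0 (enum_uniq (~: S)).
  exact: leq_trans qle.
rewrite mem_enum inE => jS ge.
have vE : (fun i => two_point a S i + h *+ (i == j)) = two_point a (j |: S).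
  apply/funext => i; rewrite /two_point !inE.
  by case: eqP => [->|_] /=; [rewrite (negbTE jS) mulr1n /h; ring|rewrite mulr0n addr0].
have [|S' [S'E S'ge]] := IHm (j |: S); first by rewrite cardsU1 jS; lia.
exists S'; split; first by rewrite S'E cardsU1 jS; lia.
move: ge; rewrite vE => ge.
have : (2 * lam * (size (enum (~: S)))%:R)^-1 <= (2 * lam * q%:R)^-1.
  rewrite lef_pV2 ?posrE ?mulr_gt0 ?ltr0n//; last exact: leq_trans qle.
  by rewrite ler_wpM2l ?ler_nat// mulr_ge0// ltW.
move: ge S'ge; rewrite /h -[m.+1%:R]natr1 [(m%:R + 1) * _]mulrDl mul1r /del.
set X := (2 * lam * q%:R)^-1; set Y := (2 * lam * _)^-1; set E := lam / 2 * _.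
by set D := m%:R * _ => ge leS YX; lra.
Qed.

End shift_stability.

Lemma expR_sub1_le (R : realType) (x : R) :
  16 * (expR (x / 16) - 1) <= expR x - 1.
Proof.
have -> : expR x = expR (x / 16) ^+ 16 by rewrite -expRM_natl; congr expR; field.
set y := expR _.
have sq (z : R) : 2 * (z - 1) <= z ^+ 2 - 1.
  by have := sqr_ge0 (z - 1); rewrite sqrrB1 mulr2n; lra.
have := sq y; have := sq (y ^+ 2); have := sq (y ^+ 4); have := sq (y ^+ 8).
by rewrite -!exprM /=; lra.
Qed.

Lemma fine_shift_event_le_err_prob (R : realType) (d : measure_display)
    (Omega : measurableType d) (P : probability Omega R) (n : nat)
    (Z : 'I_n -> Omega -> R) (iidZ : iid_std_normal P Z)
    (est : n.-tuple R -> R) (mest : measurable_fun setT est)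
    (A : set (n.-tuple R)) (mA : measurable A) (theta t : R)
    (gamma v : 'I_n -> R) :
  (forall i, theta + gamma i = v i) ->
  (forall x, A x -> t < `|est x - theta|) ->
  ((fine (P (shift_event Z A v)))%:E <= err_prob P Z est theta gamma t)%E.
Proof.
move=> vE At.
have mAv := measurable_shift_event iidZ v mA.
rewrite fineK ?fin_num_measure// /err_prob.
have obsE w : obs theta gamma Z w = [tuple Z i w + v i | i < n].
  by apply: eq_from_tnth => i; rewrite !tnth_mktuple vE addrC.
apply: le_measure; rewrite ?inE//.
  have -> : [set w | t < `|est (obs theta gamma Z w) - theta|] =
      shift_event Z [set x | t < `|est x - theta|] v.
    by apply/seteqP; split => w /=; rewrite /shift_event /= obsE.
  apply: (measurable_shift_event iidZ).
  rewrite -[X in measurable X]setTI.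
  have mN : measurable_fun setT (fun x => `|est x - theta|).
    by apply: measurableT_comp => //; exact: measurable_funB.
  have := mN measurableT _ (measurable_itv `]t, +oo[).
  by congr measurable; apply/seteqP; split => x /=; rewrite in_itv /= andbT.
by move=> w Aw /=; rewrite obsE; exact: At.
Qed.

Lemma nat_half_sqrt_bound (R : rcfType) (n k : nat) :
  n%:R / 2 - Num.sqrt n%:R < k%:R :> R -> n%:R <= 4 * k.+1%:R :> R.
Proof.
have : Num.sqrt (n%:R : R) ^+ 2 = n%:R by rewrite sqr_sqrtr.
move: (Num.sqrt _) => u; rewrite -[k.+1%:R]natr1 => <-.
by have := sqr_ge0 (u / 2 - 1); nra.
Qed.

Theorem mainTheorem7 (R : realType) :
  exists C c : R, 0 < C /\ 0 < c /\
  forall (n k : nat), (2 <= n)%N ->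
    (n%:R / 2 - Num.sqrt n%:R < k%:R :> R) -> (k%:R < n%:R / 2 :> R) ->
  forall (d : measure_display) (Omega : measurableType d)
         (P : probability Omega R) (Z : 'I_n -> Omega -> R),
    iid_std_normal P Z ->
  forall est : n.-tuple R -> R, measurable_fun setT est ->
    (c%:E <= ereal_sup
       [set e | exists (theta : R) (gamma : 'I_n -> R),
          (l0norm gamma <= k)%N /\
          e = err_prob P Z est theta gamma
                (C * Num.sqrt (ln (1 + n%:R / (n%:R - 2 * k%:R) ^+ 2)))])%E.
Proof.
exists (1 / 16), (1 / 4); split; first by lra.
split; first by lra.
move=> n k n2 lowk upk d Omega P Z iidZ est mest.
have kn : (2 * k < n)%N by rewrite -(ltr_nat R) natrM; lra.
have n4k := nat_half_sqrt_bound lowk.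
pose m := (n - 2 * k)%N.
have mE : n%:R - 2 * k%:R = m%:R :> R by rewrite /m natrB 1?ltnW// natrM.
have m0 : 0 < m%:R :> R by rewrite ltr0n subn_gt0.
have n0 : 0 < n%:R :> R by rewrite ltr0n; lia.
rewrite mE; set x := n%:R / m%:R ^+ 2.
have x0 : 0 < x by rewrite divr_gt0 ?exprn_gt0.
set s := Num.sqrt _.
have ln0 : 0 < ln (1 + x) by rewrite ln_gt0 ?ltrDl.
have s0 : 0 < s by rewrite sqrtr_gt0.
have ss : s ^+ 2 = ln (1 + x) by rewrite sqr_sqrtr// ltW.
set E := [set e | _].
pose a := s / 8.
(* [lam = 8 m / n] balances, up to constants, the two terms of the loss in
   [exists_shift_ge], whose optimal [lam] would need a square root. *)
pose del := (8 * m%:R / n%:R) / 2 * (expR ((2 * a) ^+ 2) - 1) +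
  (2 * (8 * m%:R / n%:R) * k.+1%:R)^-1.
have mdel : m%:R * del <= 1 / 2.
  have e16 : 16 * (expR ((2 * a) ^+ 2) - 1) <= x.
    have -> : (2 * a) ^+ 2 = ln (1 + x) / 16 by rewrite /a -ss; field.
    by have := expR_sub1_le (ln (1 + x)); rewrite lnK ?posrE ?addr_gt0//; lra.
  have k10 : 0 < k.+1%:R :> R by rewrite ltr0n.
  have -> : m%:R * del = (16 * (expR ((2 * a) ^+ 2) - 1)) * (m%:R ^+ 2 / n%:R) / 4 +
      n%:R / k.+1%:R / 16.
    by rewrite /del; field; rewrite !gt_eqF.
  have h1 : 16 * (expR ((2 * a) ^+ 2) - 1) * (m%:R ^+ 2 / n%:R) <= 1.
    rewrite -[leRHS](_ : x * (m%:R ^+ 2 / n%:R) = 1); last first.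
      by rewrite /x; field; rewrite !gt_eqF.
    by rewrite ler_wpM2r// divr_ge0 ?sqr_ge0// ltW.
  have h2 : n%:R / k.+1%:R <= 4 :> R by rewrite ler_pdivrMr.
  by move: h1 h2; set X := _ * (_ / _); set Y := n%:R / _; lra.
pose A : set (n.-tuple R) := est @^-1` `]-oo, 0].
have mA : measurable A by rewrite -[A]setTI; exact: mest.
have mAC : measurable (~` A) by exact: measurableC.
have [S0 S0k] : exists S : {set 'I_n}, #|S| = k.
  have /card_gt0P[S] : (0 < #|[set S : {set 'I_n} | #|S| == k]%SET|)%N.
    by rewrite card_draws card_ord bin_gt0; lia.
  by rewrite !inE => /eqP; exists S.
have lam0 : 0 < 8 * m%:R / n%:R :> R by rewrite divr_gt0// mulr_gt0.
have [|S1 [S1E S1ge]] :=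
  exists_superset_ge (m := m) (q := k.+1) (S := S0) iidZ a mA lam0 isT.
  by rewrite S0k /m; lia.
rewrite -/del in S1ge.
have ends (theta : R) (S : {set 'I_n}) (B : set (n.-tuple R)) :
    measurable B -> (#|[set i | two_point a S i != theta]%SET| <= k)%N ->
    (forall y, B y -> 1 / 16 * s < `|est y - theta|) ->
    ((fine (P (shift_event Z B (two_point a S))))%:E <= ereal_sup E)%E.
  move=> mB cardk Bt.
  apply: le_trans (ereal_sup_ubound _); last first.
    exists theta, (fun i => two_point a S i - theta); split; last by [].
    rewrite /l0norm; apply: leq_trans cardk.
    apply: subset_leq_card; apply/fintype.subsetP => i.
    by move=> /set_mem /=; rewrite finset.inE subr_eq0.
  apply: fine_shift_event_le_err_prob => // i.
  by rewrite addrC subrK.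
have a_neq : a != - a by rewrite /a; lra.
have sup0 : ((fine (P (shift_event Z (~` A) (two_point a S0))))%:E <= ereal_sup E)%E.
  apply: (ends (- a)) => //.
    rewrite -S0k subset_leq_card//; apply/fintype.subsetP => i; rewrite !inE /two_point.
    by case: (i \in S0); rewrite ?eqxx.
  move=> y /negP; rewrite /= in_itv /= -ltNge => esty.
  by rewrite opprK gtr0_norm; rewrite /a; lra.
have sup1 : ((fine (P (shift_event Z A (two_point a S1))))%:E <= ereal_sup E)%E.
  apply: (ends a) => //.
    have -> : k = #|(~: S1)%SET|.
      by rewrite cardsCs finset.setCK card_ord S1E S0k /m; lia.
    rewrite subset_leq_card//; apply/fintype.subsetP => i; rewrite !inE /two_point.
    by case: (i \in S1); rewrite ?eqxx.
  move=> y; rewrite /A /= in_itv /= => esty.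
  by rewrite distrC gtr0_norm; rewrite /a; lra.
have PC : fine (P (shift_event Z (~` A) (two_point a S0))) =
    1 - fine (P (shift_event Z A (two_point a S0))).
  rewrite (_ : shift_event Z (~` A) _ = ~` shift_event Z A (two_point a S0))//.
  have mS := measurable_shift_event iidZ (two_point a S0) mA.
  by rewrite probability_setC// fineB// fin_num_measure.
rewrite leNgt; apply/negP => sup_lt.
have {sup_lt} sup_lt (r : R) : (r%:E <= ereal_sup E)%E -> r < 1 / 4.
  by move=> rE; rewrite -lte_fin; exact: le_lt_trans sup_lt.
move: (sup_lt _ sup0) (sup_lt _ sup1); rewrite PC; lra.
Qed.
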